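(* Let $\langle M,\sigma\rangle$ be a capsule and $\alpha\in 2^\omega$. (i) If $\langle M,\sigma\rangle \Downarrow_\alpha \langle \lambda x.N,\tau\rangle$, then for every $\gamma\in 2^\omega$, $$[\![M]\!]\sigma^\star\alpha \;=\; [\![\lambda x.N]\!]\tau^\star\gamma \;=\; \mathrm{lam}\big(\lambda\beta\,v.\,[\![N]\!](\tau^\star[v/x])\beta\big),$$ where the function $\lambda\beta\,v.\,[\![N]\!](\tau^\star[v/x])\beta$ is interpreted strictly (its value is $\emptyset$ when $v=\emptyset$). (ii) If $[\![M]\!]\sigma^\star\alpha=\mathrm{lam}(f)$ for some function $f:2^\omega\to\mathrm{Val}\to\mathrm{Val}$ that is continuous (Cantor topology on $2^\omega$, Scott topology on $\mathrm{Val}$), then there is a reduced capsule $\langle v,\tau\rangle$ with $\langle M,\sigma\rangle\Downarrow_\alpha\langle v,\tau\rangle$.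
   Context: Syntax. $\mathrm{Var}$ is a countable set of variables. Terms $M,N,K\in\mathrm{Exp}$ of the stochastic $\lambda$-calculus are given by $M::= x\mid \lambda x.M\mid MN\mid M\oplus N$ ($\oplus$ is binary probabilistic choice); $\Lambda\subseteq\mathrm{Exp}$ is the set of $\lambda$-abstractions; $\mathrm{FV}(M)$ is the set of free variables; $M[y/x]$ is renaming of $x$ to $y$. Terms are taken modulo $\alpha$-conversion. Capsules. A capsule is a pair $\langle M,\sigma\rangle$ with $M\in\mathrm{Exp}$ and $\sigma$ a partial function $\mathrm{Var}\rightharpoonup\Lambda$ with finite domain such that $\mathrm{FV}(M)\subseteq\mathrm{dom}\,\sigma$ and $\mathrm{FV}(\sigma(x))\subseteq\mathrm{dom}\,\sigma$ for all $x\in\mathrm{dom}\,\sigma$. Capsules are identified modulo $\alpha$-conversion (including renaming of variables in $\mathrm{dom}\,\sigma$) and modulo removal of bindings unreachable from $M$. A capsule is reduced if its first component is in $\Lambda$. $\sigma[v/y]$ denotes $\sigma$ with $y$ (re)bound to $v$. Coins. $2^\omega$ is the set of infinite binary sequences $\alpha=\alpha_0\alpha_1\alpha_2\cdots$; $\mathrm{hd}\,\alpha=\alpha_0$, $\mathrm{tl}\,\alpha=\alpha_1\alpha_2\cdots$; for $i\in\{0,1,2\}$, $\pi_i(\alpha)=\alpha_i\alpha_{i+3}\alpha_{i+6}\cdots$. For a finite string $x\in 2^*$, $x\prec\alpha$ means $x$ is a finite prefix of $\alpha$, and $I_x=\{\alpha: x\prec\alpha\}$. Big-step semantics. $\langle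 M,\sigma\rangle\Downarrow_\alpha\langle v,\tau\rangle$ (with $\langle v,\tau\rangle$ reduced) is the least relation closed under: $\langle x,\sigma\rangle\Downarrow_\alpha\langle\sigma(x),\sigma\rangle$; $\langle\lambda x.M,\sigma\rangle\Downarrow_\alpha\langle\lambda x.M,\sigma\rangle$; if $\langle M,\sigma\rangle\Downarrow_\alpha\langle v,\tau\rangle$ then $\langle M\oplus N,\sigma\rangle\Downarrow_{0\alpha}\langle v,\tau\rangle$; if $\langle N,\sigma\rangle\Downarrow_\alpha\langle v,\tau\rangle$ then $\langle M\oplus N,\sigma\rangle\Downarrow_{1\alpha}\langle v,\tau\rangle$; if $\langle M,\sigma\rangle\Downarrow_{\pi_0(\alpha)}\langle\lambda x.K,\sigma_0\rangle$, $\langle N,\sigma_0\rangle\Downarrow_{\pi_1(\alpha)}\langle u,\sigma_1\rangle$ and $\langle K[y/x],\sigma_1[u/y]\rangle\Downarrow_{\pi_2(\alpha)}\langle v,\tau\rangle$ with $y$ fresh, then $\langle MN,\sigma\rangle\Downarrow_\alpha\langle v,\tau\rangle$. Domain. Let $Q_0=\{\emptyset\}$, $Q_{n+1}=Q_n\uplus(2^*\times\mathcal P_{\mathrm{fin}}(Q_n)\times Q_n)$, $Q=\bigcup_n Q_n$, and $\mathrm{Val}=\mathcal P(Q)$ ordered by inclusion (bottom $\emptyset$), with the Scott topology (basic opens $\{b: a\subseteq b\}$, $a$ finite). Define $\mathrm{fun}:\mathrm{Val}\to(2^\omega\to\mathrm{Val}\to\mathrm{Val})$ by $\mathrm{fun}(a)(\beta)(v)=\{q\in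 Q:\exists x\prec\beta\ \exists c\in\mathcal P_{\mathrm{fin}}(v)\ (x,c,q)\in a\}$, and for $f:2^\omega\to\mathrm{Val}\to\mathrm{Val}$, $\mathrm{lam}(f)=\{(x,c,q)\in 2^*\times\mathcal P_{\mathrm{fin}}(Q)\times Q:\forall\beta\in I_x\ q\in f\beta c\}\cup\{\emptyset\}$. Deterministic semantics. Environments are maps $e:\mathrm{Var}\to\mathrm{Val}$; $[\![M]\!]:(\mathrm{Var}\to\mathrm{Val})\to 2^\omega\to\mathrm{Val}$ is defined by: $[\![x]\!]e\alpha=e(x)$; $[\![MN]\!]e\alpha=\mathrm{fun}([\![M]\!]e(\pi_0\alpha))(\pi_2\alpha)([\![N]\!]e(\pi_1\alpha))$; $[\![\lambda x.M]\!]e\alpha=\mathrm{lam}(\lambda\beta v.[\![M]\!](e[v/x])\beta)$ where the inner function is strict (value $\emptyset$ when $v=\emptyset$); $[\![M\oplus N]\!]e\alpha=[\![M]\!]e(\mathrm{tl}\,\alpha)$ if $\mathrm{hd}\,\alpha=0$ and $[\![N]\!]e(\mathrm{tl}\,\alpha)$ if $\mathrm{hd}\,\alpha=1$. For a capsule environment $\sigma$, $\sigma^\star:\mathrm{Var}\to\mathrm{Val}$ is the least (pointwise $\subseteq$) map $\ell$ with $\ell(x)=[\![\sigma(x)]\!]\ell\alpha$ for $x\in\mathrm{dom}\,\sigma$ (independent of $\alpha$) and $\ell(x)=\emptyset$ otherwise. *)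

(* Defs.v *)
From HB Require Import structures.
From mathcomp Require Import all_boot finmap.
From mathcomp Require Import boolp classical_sets cardinality topology cantor.
Set Implicit Arguments.
Unset Strict Implicit.
Unset Printing Implicit Defensive.
Local Open Scope classical_set_scope.

(** * Syntax *)

(** Terms modulo alpha-conversion: [tm V] are the terms with free variables in
    [V]; a binder adds the variable [None].  Alpha-equivalent terms are equal;
    abstraction over a named variable is [lambda] below. *)
Inductive tm (V : Type) : Type :=
| Var of V
| Abs of tm (option V)
| App of tm V & tm V
| Oplus of tm V & tm V.

Arguments Var {V}.
Arguments Abs {V}.
Arguments App {V}.
Arguments Oplus {V}.

Fixpoint rename (V W : Type) (f : V -> W) (M : tm V) : tm W :=
  match M with
  | Var x => Var (f x)
  | Abs K => Abs (rename (omap f) K)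
  | App K N => App (rename f K) (rename f N)
  | Oplus K N => Oplus (rename f K) (rename f N)
  end.

Fixpoint FV (V : Type) (M : tm V) : seq V :=
  match M with
  | Var x => [:: x]
  | Abs K => pmap id (FV K)
  | App K N | Oplus K N => FV K ++ FV N
  end.

Definition is_abs (V : Type) (M : tm V) : bool :=
  if M is Abs _ then true else false.

(** A countably infinite set of variables. *)
Definition var : Type := nat.

Definition exp : Type := tm var.

(** [lambda x M] is the abstraction of the named variable [x] in [M]. *)
Definition lambda (x : var) (M : exp) : exp :=
  Abs (rename (fun y => if y == x then None else Some y) M).

(** [renv M y x] is M[y/x]; renaming never captures in this representation. *)
Definition renv (M : exp) (y x : var) : exp :=
  rename (fun z => if z == x then y else z) M.

(** * Capsules *)

Definition cenv : Type := {fmap var -> exp}.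

Definition capsule (M : exp) (s : cenv) : Prop :=
  {subset FV M <= domf s} /\
  forall x v, s.[? x]%fmap = Some v -> is_abs v /\ {subset FV v <= domf s}.

Definition reduced (M : exp) (s : cenv) : Prop := capsule M s /\ is_abs M.

Inductive reachable (M : exp) (s : cenv) : var -> Prop :=
| reachable_FV x : x \in FV M -> reachable M s x
| reachable_step x v y :
    reachable M s x -> s.[? x]%fmap = Some v -> y \in FV v -> reachable M s y.

(** Identification of capsules: the parts reachable from the first component
    agree up to an injective renaming.  This is alpha-conversion of capsules
    together with removal of unreachable bindings. *)
Definition capsule_equiv (M : exp) (s : cenv) (M' : exp) (s' : cenv) : Prop :=
  exists r : var -> var,
    [/\ forall x y, reachable M s x -> reachable M s y -> r x = r y -> x = y,
        M' = rename r M
      & forall x, reachable M s x ->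
          s'.[? r x]%fmap = omap (rename r) s.[? x]%fmap].

(** * Coins; [false] stands for 0 and [true] for 1 *)

Definition coins : Type := cantor_space.

Definition hd (a : coins) : bool := a 0%N.
Definition tl (a : coins) : coins := fun n => a n.+1.
Definition ccons (b : bool) (a : coins) : coins :=
  fun n => if n is m.+1 then a m else b.
Definition proj (i : nat) (a : coins) : coins := fun n => a (i + 3 * n)%N.

Definition is_prefix (x : seq bool) (a : coins) : Prop :=
  x = mkseq a (size x).

(** * Big-step semantics *)

(** The rules act on concrete representatives: the environment returned by the
    first premise of [eval_app] still has to bind the free variables of [N],
    so the identification of capsules cannot be applied between premises.
    For capsules, "[y] fresh" amounts to [y \notin domf s1], because all the
    free variables of [lambda x K] and [u] lie in [domf s1]. *)
Inductive eval : exp -> cenv -> coins -> exp -> cenv -> Prop :=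
| eval_var (x : var) (s : cenv) a v :
    s.[? x]%fmap = Some v -> eval (Var x) s a v s
| eval_abs x M s a :
    eval (lambda x M) s a (lambda x M) s
| eval_choice0 M N s a v t :
    eval M s a v t -> eval (Oplus M N) s (ccons false a) v t
| eval_choice1 M N s a v t :
    eval N s a v t -> eval (Oplus M N) s (ccons true a) v t
| eval_app M N s a x K s0 u (s1 : cenv) (y : var) v t :
    eval M s (proj 0 a) (lambda x K) s0 ->
    eval N s0 (proj 1 a) u s1 ->
    y \notin domf s1 ->
    eval (renv K y x) s1.[y <- u]%fmap (proj 2 a) v t ->
    eval (App M N) s a v t.

(** The judgement on capsules modulo identification: some representatives are
    related by the rules. *)
Definition bigstep (M : exp) (s : cenv) (a : coins) (v : exp) (t : cenv) :
    Prop :=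
  [/\ capsule M s, reduced v t
    & exists M' s' v' t',
      [/\ capsule M' s', capsule_equiv M s M' s',
          eval M' s' a v' t' & capsule_equiv v' t' v t]].

(** * Tokens *)

(** Raw tokens, with lists in place of finite sets.  [Q] consists of the raw
    tokens all of whose lists are the canonical enumeration of a finite set,
    so that Q = {empty} + 2^* x Pfin(Q) x Q; see [Qtok_inj], [Qempty_neq_tok]
    and [bigcup_Qlevel]. *)
Inductive rawtok : Type :=
| Rempty
| Rtok of seq bool & seq rawtok & rawtok.

Section RawTok.

Lemma rawtok_nested_ind (P : rawtok -> Prop) :
  P Rempty ->
  (forall x c q, foldr (fun p => and (P p)) True c -> P q -> P (Rtok x c q)) ->
  forall p, P p.
Proof.
move=> P0 PS; fix IH 1; case=> [|x c q]; first exact: P0.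
apply: PS; last exact: IH.
by elim: c => [|p c IHc]; [exact: I|split; [exact: IH|exact: IHc]].
Qed.

Fixpoint rawtok_enc (p : rawtok) : GenTree.tree (seq bool) :=
  if p is Rtok x c q then
    GenTree.Node 1 [:: GenTree.Leaf x, rawtok_enc q & map rawtok_enc c]
  else GenTree.Node 0 [::].

Fixpoint rawtok_dec (t : GenTree.tree (seq bool)) : option rawtok :=
  match t with
  | GenTree.Node 1 (GenTree.Leaf x :: q :: c) =>
      omap (Rtok x (pmap rawtok_dec c)) (rawtok_dec q)
  | _ => Some Rempty
  end.

Lemma rawtok_encK : pcancel rawtok_enc rawtok_dec.
Proof.
elim/rawtok_nested_ind => [|x c q Pc Pq] //=; rewrite Pq /=.
congr (Some (Rtok _ _ _)).
by elim: c Pc => [|p c IHc] //= [-> /IHc ->].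
Qed.

End RawTok.

HB.instance Definition _ := Countable.copy rawtok (pcan_type rawtok_encK).

Fixpoint rawtok_wf (p : rawtok) : bool :=
  if p is Rtok x c q then [&& canonical_keys c, all rawtok_wf c & rawtok_wf q]
  else true.

Record Q : Type := MkQ { rawtok_of :> rawtok; rawtok_ofP : rawtok_wf rawtok_of }.
HB.instance Definition _ := [isSub for rawtok_of].
HB.instance Definition _ := [Countable of Q by <:].

Definition Qempty : Q := @MkQ Rempty isT.

Lemma Qtok_wf (x : seq bool) (c : {fset Q}) (q : Q) :
  rawtok_wf (Rtok x (sort_keys [seq rawtok_of p | p <- c]) q).
Proof.
rewrite /= canonical_sort_keys rawtok_ofP andbT /=.
by apply/allP => p; rewrite sort_keysE => /mapP[r _ ->]; exact: rawtok_ofP.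
Qed.

(** The token (x, c, q). *)
Definition Qtok (x : seq bool) (c : {fset Q}) (q : Q) : Q := MkQ (Qtok_wf x c q).

Lemma Qempty_neq_tok x c q : Qempty <> Qtok x c q.
Proof. by move/(congr1 rawtok_of). Qed.

Lemma Qtok_inj x c q x' c' q' :
  Qtok x c q = Qtok x' c' q' -> [/\ x = x', c = c' & q = q'].
Proof.
move/(congr1 rawtok_of) => /= [-> ec eq]; split=> //; last exact: val_inj.
apply/fsetP => p; have := eq_sort_keys.2 ec => {}ec.
by rewrite -(mem_map val_inj) [LHS]ec (mem_map val_inj).
Qed.

(** The stages Q_n. *)
Fixpoint Qlevel (n : nat) : set Q :=
  if n is m.+1 then
    Qlevel m `|`
      [set r | exists x c q,
         [/\ r = Qtok x c q, [set` c] `<=` Qlevel m & Qlevel m q]]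
  else [set Qempty].

Lemma Qlevel_le m n : (m <= n)%N -> Qlevel m `<=` Qlevel n.
Proof.
move/subnK <-; elim: (n - m)%N => [|k IH] //= r /IH ?; by left.
Qed.

Lemma bigcup_Qlevel : \bigcup_n Qlevel n = setT.
Proof.
apply/seteqP; split=> // -[p pP] _.
elim/rawtok_nested_ind: p pP => [|x c q IHc IHq] pP.
  by exists 0%N => //; exact: val_inj.
have /and3P[cc /allP cP qP] := pP.
have [n _ nq] := IHq qP.
have [m mc] : exists m, forall r : Q, rawtok_of r \in c -> Qlevel m r.
  elim: c IHc cP {cc pP} => [|p c IH] /=; first by exists 0%N.
  move=> [IHp IHc] cP.
  have [m mc] := IH IHc (fun r rc => cP r (mem_behead (s := p :: c) rc)).
  have [k _ kp] := IHp (cP p (mem_head _ _)).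
  exists (maxn m k) => r; rewrite inE => /orP[/eqP rp|/mc].
    apply: (Qlevel_le (leq_maxr m k)); suff -> : r = MkQ (cP p (mem_head _ _)) by [].
    exact: val_inj.
  exact: Qlevel_le (leq_maxl m k) _.
exists (maxn m n).+1 => //=; right.
pose cQ : {fset Q} := seq_fset tt (pmap insub c).
have cQE (r : Q) : (r \in cQ) = (rawtok_of r \in c).
  by rewrite seq_fsetE mem_pmap_sub.
exists x, cQ, (MkQ qP); split.
- apply: val_inj => /=; congr Rtok; rewrite -[LHS](eqP cc).
  apply/eq_sort_keys => p; apply/idP/mapP => [pc|[r rc ->]].
    by exists (MkQ (cP p pc)) => //; rewrite cQE.
  by rewrite -cQE.
- move=> r /=; rewrite cQE => /mc.
  exact: Qlevel_le (leq_maxl m n) _.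
- exact: Qlevel_le (leq_maxr m n) _ nq.
Qed.

(** * The domain *)

Definition Val : Type := set Q.
HB.instance Definition _ := Pointed.copy Val (set Q).

(** The Scott topology: basic opens are the sets of all [b] containing a given
    finite [a]. *)
Definition Val_basic (a : set Q) : set Val := [set b | a `<=` b].

Lemma Val_basic_cover : \bigcup_(a in finite_set) Val_basic a = setT.
Proof.
by apply/seteqP; split=> // v _; exists set0; [exact: finite_set0|exact: sub0set].
Qed.

Lemma Val_basic_join (a b : set Q) (v : Val) :
  finite_set a -> finite_set b -> Val_basic a v -> Val_basic b v ->
  exists c, [/\ finite_set c, Val_basic c v
              & Val_basic c `<=` Val_basic a `&` Val_basic b].
Proof.
move=> fa fb av bv; exists (a `|` b); split.
- by rewrite finite_setU.
- by rewrite /Val_basic /= subUset.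
- by move=> w; rewrite /Val_basic /= subUset.
Qed.

HB.instance Definition _ :=
  isBaseTopological.Build Val Val_basic_cover Val_basic_join.

Definition vfun (a : Val) (b : coins) (v : Val) : Val :=
  [set q | exists x, exists c : {fset Q},
     [/\ is_prefix x b, [set` c] `<=` v & a (Qtok x c q)]].

Definition vlam (f : coins -> Val -> Val) : Val :=
  [set r | r = Qempty \/
     exists x, exists c : {fset Q}, exists q,
       r = Qtok x c q /\ forall b, is_prefix x b -> f b [set` c] q].

Definition strict (f : coins -> Val -> Val) : coins -> Val -> Val :=
  fun b v => if v == set0 then set0 else f b v.

(** Continuity of [f : coins -> Val -> Val], jointly in both arguments. *)
Definition vcontinuous (f : coins -> Val -> Val) : Prop :=
  continuous (fun p : coins * Val => f p.1 p.2).

(** * Deterministic semantics *)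

Definition ext (V : Type) (e : V -> Val) (v : Val) : option V -> Val :=
  fun x => if x is Some y then e y else v.

Fixpoint denote (V : Type) (M : tm V) (e : V -> Val) (a : coins) : Val :=
  match M with
  | Var x => e x
  | Abs K => vlam (strict (fun b v => denote K (ext e v) b))
  | App K N => vfun (denote K e (proj 0 a)) (proj 2 a) (denote N e (proj 1 a))
  | Oplus K N => if hd a then denote N e (tl a) else denote K e (tl a)
  end.

(** e[v/x] *)
Definition upd (e : var -> Val) (v : Val) (x : var) : var -> Val :=
  fun y => if y == x then v else e y.

Lemma denote_rename (V W : Type) (f : V -> W) (M : tm V) (e : W -> Val) a :
  denote (rename f M) e a = denote M (e \o f) a.
Proof.
elim: M W f e a => {V} [V x|V K IH|V K IHK N IHN|V K IHK N IHN] W f e a //=.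
- congr vlam; apply/funext => b; apply/funext => v; rewrite /strict.
  case: ifP => // _; rewrite IH; congr (denote K _ b).
  by apply/funext => -[].
- by rewrite IHK IHN.
- by rewrite IHK IHN.
Qed.

(** The clause for abstraction in its named form. *)
Lemma denote_lambda x M e a :
  denote (lambda x M) e a =
  vlam (strict (fun b v => denote M (upd e v x) b)).
Proof.
rewrite /lambda /=; congr vlam; apply/funext => b; apply/funext => v.
rewrite /strict; case: ifP => // _; rewrite denote_rename; congr denote.
by apply/funext => y; rewrite /upd /=; case: eqP.
Qed.

(** [star s] is the least solution of the equations defining sigma^*, as the
    intersection of all solutions; see [star_least]. *)
Definition star_solution (s : cenv) (l : var -> Val) : Prop :=
  forall x, if s.[? x]%fmap is Some v then forall a, l x = denote v l a
            else l x = set0.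

Definition star (s : cenv) : var -> Val :=
  fun x => \bigcap_(l in star_solution s) l x.

Lemma denote_mono (V : Type) (M : tm V) (e e' : V -> Val) a :
  (forall x, e x `<=` e' x) -> denote M e a `<=` denote M e' a.
Proof.
elim: M e e' a => {V} [V x|V K IH|V K IHK N IHN|V K IHK N IHN] e e' a ee' /=.
- exact: ee'.
- move=> r [->|[x [c [q [-> H]]]]]; first by left.
  right; exists x, c, q; split=> // b /H; rewrite /strict; case: ifP => // _.
  by apply: IH => -[].
- move=> q [x [c [xa cN H]]]; exists x, c; split=> //.
    by apply: subset_trans cN _; exact: IHN.
  exact: IHK H.
- by case: (hd a); [exact: IHN|exact: IHK].
Qed.

Lemma star_least (s : cenv) :
  (forall x v, s.[? x]%fmap = Some v -> is_abs v) ->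
  star_solution s (star s) /\
  forall l, star_solution s l -> forall x, star s x `<=` l x.
Proof.
move=> sabs; split; last by move=> l sl x q; apply.
pose a0 : coins := fun=> false.
have indep x v : s.[? x]%fmap = Some v -> forall l a, denote v l a = denote v l a0.
  by move/sabs; case: v.
pose F (l : var -> Val) x : Val :=
  if s.[? x]%fmap is Some v then denote v l a0 else set0.
have Fmono l l' : (forall x, l x `<=` l' x) -> forall x, F l x `<=` F l' x.
  by move=> ll' x; rewrite /F; case: s.[? x]%fmap => [v|] //; exact: denote_mono.
have solP l : star_solution s l <-> F l = l.
  split=> [sl|Fl x].
    by apply/funext => x; have := sl x; rewrite /F; case: s.[? x]%fmap => [v /(_ a0)|] ->.
  have := congr1 (@^~ x) Fl; rewrite /F /=.
  by case E: s.[? x]%fmap => [v|] // <- a; rewrite (indep _ _ E).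
pose m x : Val := \bigcap_(l in [set l | forall y, F l y `<=` l y]) l x.
have Fm x : F m x `<=` m x.
  by move=> q Fq l Fl; apply: (Fl); apply: Fmono Fq => y r; apply.
have mE : F m = m.
  apply/funext => x; apply/seteqP; split; first exact: Fm.
  by move=> q /(_ (F m)); apply=> y; apply: Fmono.
suff -> : star s = m by apply/solP.
apply/funext => x; apply/seteqP; split=> q.
  by apply; apply/solP.
by move=> mq l /solP Fl; apply: mq => y; rewrite Fl.
Qed.

(* Main.v *)
Require Import Defs.
From Stdlib Require List.
From mathcomp Require Import all_boot finmap.
From mathcomp Require Import boolp classical_sets cardinality topology cantor.
Set Implicit Arguments.
Unset Strict Implicit.
Unset Printing Implicit Defensive.
Local Open Scope classical_set_scope.

(* Restores the big-step relation, hidden by the evaluation map of [topology]. *)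
Local Notation eval := Defs.eval.

(* Soundness is an induction on evaluations. Environments only grow along an
   evaluation and least solutions depend only on the reachable bindings, so the
   one real step is application: it needs [fun (lam f)] to be [f] on nonempty
   values, for [f] the denotation of a body. That is the continuity of
   denotations, where Koenig's lemma supplies the uniform prefix of the coins in
   the abstraction case.
   For adequacy it is enough that the value contains the empty token. Since values
   are sets of inductively generated tokens, a Kripke realizability relation
   between tokens and reduced capsules can be defined by recursion on the token.
   Being defined tokenwise, it contains [star s] because the latter is the least
   prefixed point, with no admissibility argument. *)

(** * Renaming and free variables *)

(** The variables of [tm V] need not have decidable equality, so inductions on terms use [List.In];
    for named variables it is converted to boolean membership. *)
Lemma In_mem (T : eqType) (x : T) (s : seq T) : List.In x s <-> x \in s.
Proof.
elim: s => [|y s IH] //=; rewrite inE; split.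
  by case=> [->|/IH ->]; rewrite ?eqxx ?orbT.
by case/orP => [/eqP ->|/IH]; [left|right].
Qed.

Lemma In_pmap_id (T : Type) (x : T) (s : seq (option T)) :
  List.In x (pmap id s) <-> List.In (Some x) s.
Proof.
elim: s => [|[y|] s IH] //=; rewrite IH; first by split=> -[?|?]; by [left; congruence|right].
by split; [right|case].
Qed.

Lemma rename_comp (U V W : Type) (f : U -> V) (g : V -> W) (M : tm U) :
  rename g (rename f M) = rename (g \o f) M.
Proof.
elim: M V W f g => {U} [U x|U K IH|U K IHK N IHN|U K IHK N IHN] V W f g //=;
  rewrite ?IHK ?IHN ?IH //; congr (Abs (rename _ K)); by apply/funext => -[].
Qed.

Lemma eq_rename_FV (V W : Type) (f g : V -> W) (M : tm V) :
  (forall x, List.In x (FV M) -> f x = g x) -> rename f M = rename g M.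
Proof.
elim: M W f g => {V} [V x|V K IH|V K IHK N IHN|V K IHK N IHN] W f g /= fg.
- by rewrite fg //; left.
- congr Abs; apply: IH => -[x|] //= xK; rewrite fg //; exact/In_pmap_id.
- by congr App; [apply: IHK|apply: IHN] => x ?; apply: fg; apply/List.in_app_iff; auto.
- by congr Oplus; [apply: IHK|apply: IHN] => x ?; apply: fg; apply/List.in_app_iff; auto.
Qed.

Lemma rename_id (V : Type) (M : tm V) : rename id M = M.
Proof.
elim: M => {V} [V x|V K IH|V K IHK N IHN|V K IHK N IHN] //=; rewrite ?IHK ?IHN //.
by rewrite -[in RHS]IH; congr (Abs (rename _ K)); apply/funext => -[].
Qed.

Lemma FV_rename (V W : Type) (f : V -> W) (M : tm V) :
  FV (rename f M) = map f (FV M).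
Proof.
elim: M W f => {V} [V x|V K IH|V K IHK N IHN|V K IHK N IHN] W f //=;
  rewrite ?IHK ?IHN ?map_cat // IH.
by elim: (FV K) => [|[x|] s IHs] //=; rewrite IHs.
Qed.

Lemma is_absP (V : Type) (M : tm V) : is_abs M -> exists K, M = Abs K.
Proof. by case: M => // K; exists K. Qed.

Definition close_var (x : var) (M : exp) : tm (option var) :=
  rename (fun y => if y == x then None else Some y) M.

Lemma renv_close_var (x y : var) (K : exp) :
  renv K y x = rename (odflt y) (close_var x K).
Proof.
rewrite /close_var rename_comp /renv; congr rename; apply/funext => z /=.
by case: eqP.
Qed.

Lemma exists_notin (s : seq var) : exists y, y \notin s.
Proof.
exists (\max_(z <- s) z).+1; apply/negP => /(@leq_bigmax_seq _ _ xpredT id) /(_ isT).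
by rewrite ltnn.
Qed.

(** Naming the bound variable by an [x] outside the free variables of [Abs K] and closing over it
    again restores [K]. Hence the rules stated for [lambda x M] cover every [Abs K]. *)
Lemma Abs_lambda (K : tm (option var)) :
  exists x K', K = close_var x K'.
Proof.
have [x xK] := exists_notin (pmap id (FV K)).
exists x, (rename (odflt x) K); rewrite /close_var rename_comp -[LHS]rename_id.
apply: eq_rename_FV => -[z|] zK /=; last by rewrite eqxx.
case: eqP => // zx; case/negP: xK; rewrite -zx; apply/In_mem/In_pmap_id.
exact: zK.
Qed.

Lemma eq_denote_FV (V : Type) (M : tm V) (e e' : V -> Val) a :
  (forall x, List.In x (FV M) -> e x = e' x) -> denote M e a = denote M e' a.
Proof.
elim: M e e' a => {V} [V x|V K IH|V K IHK N IHN|V K IHK N IHN] e e' a /= ee'.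
- by apply: ee'; left.
- congr vlam; apply/funext => b; apply/funext => v; rewrite /strict.
  case: ifP => // _; apply: IH => -[x|] //= xK; apply: ee'; exact/In_pmap_id.
- by rewrite (IHK e e') ?(IHN e e') // => x ?; apply: ee'; apply/List.in_app_iff; auto.
- by rewrite (IHK e e') ?(IHN e e') // => x ?; apply: ee'; apply/List.in_app_iff; auto.
Qed.

Lemma denote_abs_const (V : Type) (M : tm V) (e : V -> Val) a b :
  is_abs M -> denote M e a = denote M e b.
Proof. by case: M. Qed.

Lemma denote_abs_Qempty (V : Type) (M : tm V) (e : V -> Val) a :
  is_abs M -> denote M e a Qempty.
Proof. by case: M => // K _; left. Qed.

(** * Continuity of the denotation *)

Definition agree (n : nat) (a b : coins) : Prop := forall k, (k < n)%N -> b k = a k.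

Lemma agree_le m n a b : (m <= n)%N -> agree n a b -> agree m a b.
Proof. by move=> mn ab k km; apply: ab; apply: leq_trans mn. Qed.

Lemma agree_prefix n a b : is_prefix (mkseq a n) b <-> agree n a b.
Proof.
rewrite /is_prefix size_mkseq; split=> [ab k kn|ab].
  by have := congr1 (nth false ^~ k) ab; rewrite /= !nth_mkseq.
by apply/eq_in_map => k; rewrite mem_iota add0n => /ab ->.
Qed.

Lemma agree_is_prefix x a b : is_prefix x a -> agree (size x) a b -> is_prefix x b.
Proof. by move=> xa /agree_prefix; rewrite -xa. Qed.

Lemma agree_proj i n a b : (i < 3)%N -> agree (3 * n) a b ->
  agree n (proj i a) (proj i b).
Proof.
move=> i3 ab k kn; apply: ab.
apply: (@leq_trans (3 + 3 * k)); first by rewrite ltn_add2r.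
by rewrite -mulnS leq_mul2l.
Qed.

(** Contrapositively, from a root where [P] fails one can always descend to a child where it fails,
    and the resulting branch never meets [P]. *)
Lemma koenig (P : seq bool -> Prop) :
  (forall w, (forall b, P (rcons w b)) -> P w) ->
  (forall a : coins, exists n, P (mkseq a n)) ->
  P [::].
Proof.
move=> Pstep Pbar; apply: contrapT => nP0.
have /choice[g gP] : forall w, exists b, ~ P w -> ~ P (rcons w b).
  move=> w; apply: contrapT => /forallNP nb.
  apply: (nb true) => nPw _; apply: nPw; apply: Pstep => b.
  by apply: contrapT => nPb; apply: (nb b).
pose w := fix w n := if n is m.+1 then rcons (w m) (g (w m)) else [::].
have [n] := Pbar (g \o w).
suff -> : mkseq (g \o w) n = w n by elim: n => //= n IH; apply: gP.
by elim: n => //= n IH; rewrite mkseqS IH.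
Qed.

(** By monotonicity of [A], the union of the finite environments and the maximum of the prefix
    lengths serve all members of [s] at once. *)
Lemma finitary_family (T : eqType) (V : Type) (e : V -> Val) (a : coins)
    (A : T -> (V -> Val) -> coins -> Prop) (s : seq T) :
  (forall p e1 e2 b, (forall x, e1 x `<=` e2 x) -> A p e1 b -> A p e2 b) ->
  (forall p, p \in s -> exists (d : V -> {fset Q}) n,
     (forall x, [set` d x] `<=` e x) /\
     forall b, agree n a b -> A p (fun x => [set` d x]) b) ->
  exists (d : V -> {fset Q}) n,
     (forall x, [set` d x] `<=` e x) /\
     forall b, agree n a b -> forall p, p \in s -> A p (fun x => [set` d x]) b.
Proof.
move=> Amono; elim: s => [|p s IH] As.
  by exists (fun=> fset0), 0%N; split=> // x r /=; rewrite inE.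
have [d1 [n1 [de1 H1]]] := As p (mem_head _ _).
have [|d2 [n2 [de2 H2]]] := IH; first by move=> r rs; apply: As; rewrite inE rs orbT.
exists (fun x => d1 x `|` d2 x)%fset, (maxn n1 n2); split=> [x r /=|b ab r].
  by rewrite inE => /orP[/de1|/de2].
rewrite inE => /predU1P[->|rs].
  apply: Amono (H1 b (agree_le (leq_maxl _ _) ab)) => x t /=.
  by rewrite inE => ->.
apply: Amono (H2 b (agree_le (leq_maxr _ _) ab) r rs) => x t /=.
by rewrite inE orbC => ->.
Qed.

(** Under a binder, every coin sequence extending the prefix of the token has its own finite
    environment, and [koenig] merges them into a single one. *)
Lemma denote_finitary (V : Type) (M : tm V) (e : V -> Val) a q :
  denote M e a q ->
  exists (d : V -> {fset Q}) n,
    (forall x, [set` d x] `<=` e x) /\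
    forall b, agree n a b -> denote M (fun x => [set` d x]) b q.
Proof.
elim: M e a q => {V} [V x|V K IH|V K IHK N IHN|V K IHK N IHN] e a q /=.
- move=> qx; exists (fun y => if pselect (y = x) then [fset q]%fset else fset0), 0%N.
  split=> [y r /=|b _ /=]; last by case: pselect => //= _; rewrite inE.
  by case: pselect => [yx|_] /=; rewrite inE // => /eqP ->; rewrite yx.
- case=> [->|[x [c [r [-> H]]]]].
    by exists (fun=> fset0), 0%N; split=> [y r /=|b _]; [rewrite inE|left].
  pose A (d : V -> {fset Q}) b :=
    strict (fun b v => denote K (ext (fun y => [set` d y]) v) b) b [set` c] r.
  have Amono d1 d2 b : (forall y, [set` d1 y] `<=` [set` d2 y]) -> A d1 b -> A d2 b.
    move=> d12; rewrite /A /strict; case: ifP => // _.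
    by apply: denote_mono => -[].
  (* The trivial prefix is kept so that the goal becomes [P [::]], where [P w] asks for one finite
     environment that serves all coins extending both [w] and [x]. *)
  suff [d [de dP]] : exists d : V -> {fset Q}, (forall y, [set` d y] `<=` e y) /\
      forall b, is_prefix [::] b -> is_prefix x b -> A d b.
    exists d, 0%N; split=> // _ _; right; exists x, c, r; split=> // b.
    exact: dP.
  pose P w := exists d : V -> {fset Q}, (forall y, [set` d y] `<=` e y) /\
      forall b, is_prefix w b -> is_prefix x b -> A d b.
  apply: (@koenig P) => [w Pw|a'].
    have [d1 [de1 H1]] := Pw false; have [d2 [de2 H2]] := Pw true.
    exists (fun x => d1 x `|` d2 x)%fset; split=> [y t /=|b wb xb].
      by rewrite inE => /orP[/de1|/de2].
    have : is_prefix (rcons w (b (size w))) b.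
      by rewrite /is_prefix size_rcons mkseqS -wb.
    case: (b _) => [/H2|/H1] /(_ xb); apply: Amono => y t /=; rewrite inE => ->;
      by rewrite ?orbT.
  have [xa'|nxa'] := pselect (is_prefix x a'); last first.
    (* On a branch that does not extend [x], the condition is void after [size x] coins. *)
    exists (size x), (fun=> fset0); split=> [y t /=|b /agree_prefix ab xb].
      by rewrite inE.
    case: nxa'; apply: agree_is_prefix xb _ => k /ab //.
  have := H a' xa'; rewrite /strict; case: ifP => // c0 Hr.
  have [d [n [de dP]]] := IH _ _ _ Hr.
  exists n, (d \o Some); split=> [y|b /agree_prefix ab _]; first exact: de (Some y).
  rewrite /A /strict c0; apply: denote_mono (dP b ab) => -[y|] //=.
- move=> [x [c [xa cN Hq]]].
  have [d1 [n1 [de1 H1]]] := IHK _ _ _ Hq.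
  have [||d2 [n2 [de2 H2]]] := @finitary_family _ _ e (proj 1 a)
    (fun p e b => denote N e b p) c; first by move=> *; apply: denote_mono.
    by move=> p /cN /IHN.
  (* Each of the three projections must retain the longest prefix needed, hence the factor 3. *)
  exists (fun x => d1 x `|` d2 x)%fset, (3 * maxn (size x) (maxn n1 n2))%N.
  split=> [y t /=|b ab]; first by rewrite inE => /orP[/de1|/de2].
  have ab3 i m : (i < 3)%N -> (m <= maxn (size x) (maxn n1 n2))%N ->
      agree m (proj i a) (proj i b).
    by move=> i3 mx; apply: agree_le mx _; exact: agree_proj.
  exists x, c; split.
  + by apply: agree_is_prefix xa _; apply: ab3; rewrite // leq_maxl.
  + move=> p pc; have /H2/(_ p pc) : agree n2 (proj 1 a) (proj 1 b).
      by apply: ab3; rewrite // !leq_max leqnn !orbT.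
    by apply: denote_mono => y t /=; rewrite inE orbC => ->.
  + have /H1 : agree n1 (proj 0 a) (proj 0 b).
      by apply: ab3; rewrite // !leq_max leqnn !orbT.
    by apply: denote_mono => y t /=; rewrite inE => ->.
- have agreeS n b : agree n.+1 a b -> hd b = hd a /\ agree n (tl a) (tl b).
    by move=> ab; split; [exact: ab|move=> k kn; exact: ab].
  case hda: (hd a) => H; [have := IHN _ _ _ H|have := IHK _ _ _ H];
    move=> [d [n [de dP]]]; exists d, n.+1;
    by split=> // b /agreeS[]; rewrite hda => -> /dP.
Qed.

(** Left to right is monotonicity; right to left, [denote_finitary] supplies the finite part of [v]
    and the finite prefix of [b] that form the token. *)
Lemma vfun_vlam_denote (V : Type) (K : tm (option V)) (e : V -> Val) b (v : Val) :
  v !=set0 ->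
  vfun (vlam (strict (fun b v => denote K (ext e v) b))) b v = denote K (ext e v) b.
Proof.
move=> [p vp]; apply/seteqP; split=> q.
  move=> [x [c [xb cv [/esym/Qempty_neq_tok //|[x' [c' [q' [/Qtok_inj[<- <- <-]]]]]]]]].
  move=> /(_ b xb); rewrite /strict; case: ifP => // _.
  by apply: denote_mono => -[y|] /=.
move=> /denote_finitary[d [n [de dP]]].
(* Adding [p] keeps the finite argument nonempty, as strictness demands. *)
exists (mkseq b n), (p |` d None)%fset; split; first exact/agree_prefix.
  by move=> r /=; rewrite !inE => /predU1P[->//|/(de None)].
right; do 3 eexists; split; first by [].
move=> b' /agree_prefix /dP; rewrite /strict; case: ifPn => [/eqP c0|_].
  have : [set` (p |` d None)%fset] p by rewrite /= !inE eqxx.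
  by rewrite c0.
apply: denote_mono => -[y|] /=; first exact: de (Some y).
by move=> t /= td; rewrite !inE td orbT.
Qed.

(** * Capsule environments *)

(** Convertible to the second half of [capsule], so [.2] of a capsule hypothesis proves it. *)
Definition closed_env (s : cenv) : Prop :=
  forall x v, s.[? x]%fmap = Some v -> is_abs v /\ {subset FV v <= domf s}.

Definition sub_env (s t : cenv) : Prop :=
  forall x v, s.[? x]%fmap = Some v -> t.[? x]%fmap = Some v.

Lemma sub_env_trans (s t u : cenv) : sub_env s t -> sub_env t u -> sub_env s u.
Proof. by move=> st tu x v /st /tu. Qed.

Lemma fnd_domf (s : cenv) x v : s.[? x]%fmap = Some v -> x \in domf s.
Proof. by rewrite -fndSome => ->. Qed.

Lemma domf_fnd (s : cenv) x : x \in domf s -> exists v, s.[? x]%fmap = Some v.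
Proof. by rewrite -fndSome; case: s.[? x]%fmap => // v _; exists v. Qed.

Lemma sub_env_domf (s t : cenv) : sub_env s t -> {subset domf s <= domf t}.
Proof. by move=> st x /domf_fnd[v /st /fnd_domf]. Qed.

Lemma sub_env_set (s : cenv) y u : y \notin domf s -> sub_env s s.[y <- u]%fmap.
Proof.
move=> ys x v sx; rewrite fnd_set; case: eqP => // xy.
by rewrite -xy (fnd_domf sx) in ys.
Qed.

Lemma capsule_sub (M : exp) (s t : cenv) :
  capsule M s -> sub_env s t -> closed_env t -> capsule M t.
Proof. by move=> [Ms _] st ct; split=> // x /Ms; exact: sub_env_domf. Qed.

Lemma capsule_App (M N : exp) (s : cenv) :
  capsule (App M N) s -> capsule M s /\ capsule N s.
Proof.
by move=> [Ms cs]; split; split=> // x xM; apply: Ms; rewrite /= mem_cat xM ?orbT.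
Qed.

Lemma closed_env_set (s : cenv) y u :
  capsule u s -> is_abs u -> closed_env s.[y <- u]%fmap.
Proof.
move=> [us cs] au x v; rewrite fnd_set.
have sub : {subset domf s <= domf s.[y <- u]%fmap}.
  by move=> z zs; rewrite mem_setf inE zs orbT.
case: eqP => [_ [<-]|_ /cs[av vs]]; split=> // z; first by move/us/sub.
by move/vs/sub.
Qed.

Lemma capsule_body (K : tm (option var)) (s : cenv) y u :
  capsule (Abs K) s -> capsule u s -> is_abs u ->
  capsule (rename (odflt y) K) s.[y <- u]%fmap.
Proof.
move=> [Ks cs] cu au; split; last exact: closed_env_set.
move=> x; rewrite FV_rename mem_setf inE => /mapP[[z|] zK ->] /=; last by rewrite eqxx.
by rewrite Ks ?orbT //=; apply/In_mem/In_pmap_id/In_mem.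
Qed.

(** The only new bindings are those of a fresh [y] in the application rule, so no binding is ever
    overwritten. *)
Lemma eval_capsule M s a v t : eval M s a v t -> capsule M s ->
  [/\ capsule v t, is_abs v & sub_env s t].
Proof.
elim=> {M s a v t} [x s a v sx|x M s a|M N s a v t _ IH|M N s a v t _ IH|].
- by move=> [_ cs]; have [av vs] := cs _ _ sx; split.
- by move=> cM; split.
- by move=> /capsule_App[/IH].
- by move=> /capsule_App[_ /IH].
move=> M N s a x K s0 u s1 y v t _ IHM _ IHN ys1 _ IHK /capsule_App[cM cN].
have [cK _ ss0] := IHM cM.
have [cu au s01] := IHN (capsule_sub cN ss0 cK.2).
rewrite renv_close_var in IHK.
have [cv av s1t] := IHK (capsule_body y (capsule_sub cK s01 cu.2) cu au).
split=> //; apply: sub_env_trans ss0 _; apply: sub_env_trans s01 _.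
by apply: sub_env_trans s1t; exact: sub_env_set.
Qed.

(** * Least solutions *)

Lemma star_eq (s : cenv) x v a : closed_env s ->
  s.[? x]%fmap = Some v -> star s x = denote v (star s) a.
Proof.
by move=> cs sx; have [/(_ x)] := star_least (fun y w sy => (cs y w sy).1); rewrite sx.
Qed.

(** The intersection [m] of the prefixed points is a fixed point (Knaster-Tarski), hence a solution,
    so [star s] lies below [m] and thus below [l]. *)
Lemma star_le_prefixed (s : cenv) (l : var -> Val) a : closed_env s ->
  (forall x v, s.[? x]%fmap = Some v -> denote v l a `<=` l x) ->
  forall x, star s x `<=` l x.
Proof.
move=> cs ls.
pose F (k : var -> Val) x : Val :=
  if s.[? x]%fmap is Some v then denote v k a else set0.
have Fmono k k' : (forall x, k x `<=` k' x) -> forall x, F k x `<=` F k' x.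
  by move=> kk' x; rewrite /F; case: s.[? x]%fmap => [v|] //; exact: denote_mono.
pose m x : Val := \bigcap_(k in [set k | forall y, F k y `<=` k y]) k x.
have Fm x : F m x `<=` m x.
  by move=> q Fq k Fk; apply: (Fk); apply: Fmono Fq => y r; apply.
have mE : F m = m.
  apply/funext => x; apply/seteqP; split; first exact: Fm.
  by move=> q /(_ (F m)); apply=> y; apply: Fmono.
move=> x q /(_ m) mq.
have /mq : star_solution s m.
  move=> y; rewrite -mE {1 3}/F; case E: s.[? y]%fmap => [v|] // b.
  by rewrite mE; exact: denote_abs_const (cs _ _ E).1.
apply=> y r; rewrite /F; case E: s.[? y]%fmap => [v|] //; exact: ls E _.
Qed.

(** As [P] is closed under reachability, each inclusion follows from [star_le_prefixed]. [P] will be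
    the domain of a smaller environment, or the variables reachable in a capsule. *)
Lemma star_morph (s s' : cenv) (P : var -> Prop) (r : var -> var) :
  closed_env s -> closed_env s' ->
  (forall x v y, P x -> s.[? x]%fmap = Some v -> y \in FV v -> P y) ->
  (forall x y, P x -> P y -> r x = r y -> x = y) ->
  (forall x, P x -> s'.[? r x]%fmap = omap (rename r) s.[? x]%fmap) ->
  forall x, P x -> star s x = star s' (r x).
Proof.
move=> cs cs' Pstep rinj rs.
pose a : coins := fun=> false.
move=> x Px; apply/seteqP; split.
  (* Off [P] the candidate is [setT], where the prefixed-point condition is trivial. *)
  pose l y := if pselect (P y) then star s' (r y) else setT.
  have -> : star s' (r x) = l x by rewrite /l; case: pselect.
  apply: (star_le_prefixed (a := a)) => // {x Px} x v sx; rewrite {2}/l.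
  case: pselect => // Px; rewrite (@star_eq s' (r x) (rename r v) a) // ?rs ?sx //.
  rewrite denote_rename (@eq_denote_FV _ v l (star s' \o r)) // => y yv.
  by rewrite /l /=; case: pselect => // -[]; apply: (Pstep x v) => //; apply/In_mem.
(* Outside the image of [P] the candidate is [setT], so that the prefixed-point
   condition only has to be checked on the image. *)
pose l z : Val := [set q | forall y, P y -> r y = z -> star s y q].
have lr y : P y -> l (r y) = star s y.
  move=> Py; apply/seteqP; split=> q; first by apply.
  by move=> yq y' Py' /rinj ->.
rewrite -(lr x Px); apply: (star_le_prefixed (a := a)) => // z v' sz q qv' y Py ry.
subst z; move: sz; rewrite rs //; case E: s.[? y]%fmap => [v|] //= [v'E].
rewrite (star_eq a cs E); move: qv'; rewrite -v'E denote_rename.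
rewrite (@eq_denote_FV _ v (l \o r) (star s)) // => w wv /=; apply: lr.
by apply: (Pstep y v) => //; apply/In_mem.
Qed.

Lemma denote_sub_env (M : exp) (s t : cenv) a :
  capsule M s -> sub_env s t -> closed_env t ->
  denote M (star s) a = denote M (star t) a.
Proof.
move=> [Ms cs] st ct; apply: eq_denote_FV => x /In_mem /Ms xs.
apply: (@star_morph s t (fun y => y \in domf s) id) => // [y v z _ /cs[_ vs] /vs //|y].
by move=> /domf_fnd[v sy]; rewrite sy (st _ _ sy) /= rename_id.
Qed.

Lemma denote_capsule_equiv M s M' s' a :
  capsule M s -> capsule M' s' -> capsule_equiv M s M' s' ->
  denote M (star s) a = denote M' (star s') a.
Proof.
move=> cM cM' [r [rinj -> rs]]; rewrite denote_rename.
apply: eq_denote_FV => x /In_mem xM.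
apply: (@star_morph s s' (reachable M s)) => //; first exact: cM.2.
- exact: cM'.2.
- exact: reachable_step.
- exact: reachable_FV.
Qed.

(** * Soundness *)

(** A fresh [y] does not alter the value of [u], and [star] unfolds at [y] to that value; so
    extending the capsule matches extending the semantic environment. *)
Lemma denote_body (K : tm (option var)) (s : cenv) y u a b :
  capsule (Abs K) s -> capsule u s -> is_abs u -> y \notin domf s ->
  denote K (ext (star s) (denote u (star s) b)) a =
  denote (rename (odflt y) K) (star s.[y <- u]%fmap) a.
Proof.
move=> cK cu au ys; have cs' := closed_env_set (y := y) cu au.
have ss' := sub_env_set u ys.
rewrite denote_rename; apply: eq_denote_FV => -[z|] zK /=; last first.
  rewrite (@star_eq _ y u b) // ?fnd_set ?eqxx //.
  exact: denote_sub_env.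
have := @denote_sub_env (Var z) s _ a _ ss' cs'; apply; split; last exact: cK.2.
move=> w; rewrite /= inE => /eqP ->; apply: cK.1; exact/In_mem/In_pmap_id.
Qed.

Lemma eval_sound M s a v t : eval M s a v t -> capsule M s ->
  forall b, denote M (star s) a = denote v (star t) b.
Proof.
elim=> {M s a v t} [x s a v sx|x M s a|M N s a v t _ IH|M N s a v t _ IH|].
- by move=> [_ cs] b /=; exact: star_eq.
- by move=> _ b; exact: denote_abs_const.
- by move=> /capsule_App[/IH].
- by move=> /capsule_App[_ /IH].
move=> M N s a x K s0 u s1 y v t eM IHM eN IHN ys1 _ IHK /capsule_App[cM cN] b.
have [cK _ ss0] := eval_capsule eM cM.
have cN0 := capsule_sub cN ss0 cK.2.
have [cu au s01] := eval_capsule eN cN0.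
have cK1 := capsule_sub cK s01 cu.2.
rewrite renv_close_var in IHK.
rewrite -(IHK (capsule_body y cK1 cu au) b) -(denote_body (proj 2 a) a cK1 cu au ys1).
(* Function and argument are both expressed over [star s1], where [vfun_vlam_denote] performs the
   beta step. *)
rewrite /= (IHM cM a) (denote_sub_env a cK s01 cu.2).
rewrite (denote_sub_env _ cN ss0 cK.2) (IHN cN0 a) vfun_vlam_denote //.
by exists Qempty; exact: denote_abs_Qempty.
Qed.

(** * Adequacy *)

(* The body of an abstraction is entered at every fresh name and in every
   extension of the environment. The condition on all evaluations, next to the
   existence of one, makes a determinism lemma for [eval] unnecessary. An empty
   [c] is excluded because denotations of abstractions are strict. *)
Fixpoint realizes (q : rawtok) (v : exp) (s : cenv) : Prop :=
  if q is Rtok x c q then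
    c <> [::] /\
    exists K, v = Abs K /\
    forall b t u y, is_prefix x b -> sub_env s t -> capsule u t -> is_abs u ->
      foldr (fun p => and (realizes p u t)) True c -> y \notin domf t ->
      (exists v' t', eval (rename (odflt y) K) t.[y <- u]%fmap b v' t') /\
      forall v' t', eval (rename (odflt y) K) t.[y <- u]%fmap b v' t' ->
        realizes q v' t'
  else True.

Lemma foldr_andP (T : eqType) (P : T -> Prop) (s : seq T) :
  foldr (fun p => and (P p)) True s <-> forall p, p \in s -> P p.
Proof.
elim: s => [|p s IH] //=; rewrite IH; split.
  by move=> [Pp Ps] r; rewrite inE => /predU1P[->|/Ps].
by move=> Ps; split=> [|r rs]; apply: Ps; rewrite inE ?eqxx ?rs ?orbT.
Qed.

(** The clause for [Rtok] already quantifies over all extensions of the environment. *)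
Lemma realizes_sub (q : rawtok) v s t :
  realizes q v s -> sub_env s t -> realizes q v t.
Proof.
case: q => [//|x c q] /= [c0 [K [-> H]]] st; split=> //; exists K; split=> //.
by move=> b t' u y xb tt'; apply: H => //; exact: sub_env_trans tt'.
Qed.

Lemma eval_AbsE K s a v t : eval (Abs K) s a v t -> v = Abs K /\ t = s.
Proof. by move=> e; inversion e. Qed.

Lemma eval_Abs K s a : eval (Abs K) s a (Abs K) s.
Proof. by have [x [K' ->]] := Abs_lambda K; exact: eval_abs. Qed.

Lemma eval_VarE x s a v t : eval (Var x) s a v t -> s.[? x]%fmap = Some v /\ t = s.
Proof. by move=> e; inversion e. Qed.

Lemma eval_OplusE M N s a v t : eval (Oplus M N) s a v t ->
  eval (if hd a then N else M) s (tl a) v t.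
Proof. by move=> e; inversion e. Qed.

Lemma ccons_hd_tl a : ccons (hd a) (tl a) = a.
Proof. by apply/funext => -[]. Qed.

Lemma eval_Oplus M N s a v t :
  eval (if hd a then N else M) s (tl a) v t -> eval (Oplus M N) s a v t.
Proof.
rewrite -{3}(ccons_hd_tl a).
by case: (hd a); [exact: eval_choice1|exact: eval_choice0].
Qed.

Lemma eval_AppE M N s a v t : eval (App M N) s a v t ->
  exists K s0 u s1 y,
    [/\ eval M s (proj 0 a) (Abs K) s0, eval N s0 (proj 1 a) u s1, y \notin domf s1
      & eval (rename (odflt y) K) s1.[y <- u]%fmap (proj 2 a) v t].
Proof.
move=> e; inversion e as [| | | |M' N' s' a' x K s0 u s1 y v' t' eM eN ys1 eK]; subst.
exists (close_var x K), s0, u, s1, y; split=> //.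
by rewrite -renv_close_var.
Qed.

Lemma eval_App M N s a K s0 u (s1 : cenv) (y : var) v t :
  eval M s (proj 0 a) (Abs K) s0 -> eval N s0 (proj 1 a) u s1 -> y \notin domf s1 ->
  eval (rename (odflt y) K) s1.[y <- u]%fmap (proj 2 a) v t ->
  eval (App M N) s a v t.
Proof.
by have [x [K' ->]] := Abs_lambda K; rewrite -renv_close_var; exact: eval_app.
Qed.

(** The fundamental lemma of the relation. [r] places the variables of [M] in the capsule
    environment, so that the induction can pass under a binder, where [None] goes to the fresh name
    [y]. *)
Lemma realizes_denote (V : Type) (M : tm V) (r : V -> var) (s : cenv)
    (e : V -> Val) a (q : Q) :
  capsule (rename r M) s ->
  (forall x, List.In x (FV M) -> forall p : Q, e x p ->
     exists2 w, s.[? r x]%fmap = Some w & realizes p w s) ->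
  denote M e a q ->
  (exists v t, eval (rename r M) s a v t) /\
  forall v t, eval (rename r M) s a v t -> realizes q v t.
Proof.
elim: M r s e a q => {V} [V x|V K IH|V K IHK N IHN|V K IHK N IHN] r s e a q /=.
- move=> _ er eq; have [|w sx qw] := er x _ q eq; first by left.
  split; first by exists w, s; exact: eval_var.
  by move=> v t /eval_VarE[]; rewrite sx => -[<-] ->.
- move=> cK er qK; split; first by do 2 eexists; exact: eval_Abs.
  move=> v t /eval_AbsE[-> ->]; case: qK => [->//|[x [c [p [-> H]]]]] /=.
  have {}H b : is_prefix x b -> c != fset0 /\ denote K (ext e [set` c]) b p.
    move=> /H; rewrite /strict; case: ifPn => // c0; split=> //.
    by apply: contra c0 => /eqP ->; apply/eqP/seteqP; split=> z //=; rewrite inE.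
  split.
    (* Padding [x] with zeros gives coins at which strictness shows [c] nonempty. *)
    have /H[/fset0Pn[z zc] _] : is_prefix x (nth false x).
      by rewrite /is_prefix [RHS](@mkseq_nth _ false).
    move=> c0; suff : rawtok_of z \in [::] by [].
    by rewrite -c0 sort_keysE; apply/mapP; exists z.
  eexists; split; first by [].
  move=> b t' u y /H[_ pK] st' cu au /foldr_andP uc yt'.
  have ct' := capsule_sub cK st' cu.2.
  have ss' := sub_env_set u yt'.
  rewrite rename_comp; apply: IH pK.
    by rewrite -rename_comp; exact: capsule_body.
  move=> [z|] zK z' /= ez'.
    have [|w sz wr] := er z _ z' ez'; first exact/In_pmap_id.
    exists w; first exact/ss'/st'.
    by apply: realizes_sub wr _; exact: sub_env_trans ss'.
  exists u; first by rewrite fnd_set eqxx.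
  apply: realizes_sub ss'; apply: uc; rewrite sort_keysE; apply/mapP.
  by exists z'.
- move=> /capsule_App[cK cN] er [x [c [xa cN' qK]]].
  have erK z : List.In z (FV K) -> List.In z (FV K ++ FV N).
    by move=> ?; apply/List.in_app_iff; left.
  have erN z : List.In z (FV N) -> List.In z (FV K ++ FV N).
    by move=> ?; apply/List.in_app_iff; right.
  have [[v0 [s0 ev0]] realK] := IHK _ _ _ _ _ cK (fun z zK => er z (erK z zK)) qK.
  (* [N] runs in the environment left by the function part, so its induction hypothesis is needed in
     every extension of [s]. *)
  have realN s' : sub_env s s' -> closed_env s' -> forall p, p \in c ->
      (exists v t, eval (rename r N) s' (proj 1 a) v t) /\
      forall v t, eval (rename r N) s' (proj 1 a) v t -> realizes p v t.
    move=> ss' cs' p /cN'; apply: IHN; first exact: capsule_sub cN ss' cs'.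
    move=> z /erN/er H p' /H[w sz pw]; exists w; first exact: ss'.
    exact: realizes_sub pw ss'.
  (* The function part realizes the token with argument set [c], so its body can be entered once the
     argument realizes all of [c]. *)
  have body K' s1 : eval (rename r K) s (proj 0 a) (Abs K') s1 ->
      (exists u t, eval (rename r N) s1 (proj 1 a) u t) /\
      forall u t y, eval (rename r N) s1 (proj 1 a) u t -> y \notin domf t ->
      (exists v' t', eval (rename (odflt y) K') t.[y <- u]%fmap (proj 2 a) v' t') /\
      forall v' t', eval (rename (odflt y) K') t.[y <- u]%fmap (proj 2 a) v' t' ->
        realizes q v' t'.
    move=> eK; have [cK' _ ss1] := eval_capsule eK cK.
    have {}realN := realN s1 ss1 cK'.2.
    have /= [c0 [_ [[<-] H]]] := realK _ _ eK.
    split.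
      (* Any token of the nonempty [c] makes [N] converge. *)
      have [/eqP cE|/fset0Pn[p /realN[]//]] := boolP (c == fset0).
      by case: c0; have -> : [seq rawtok_of p | p <- c] = [::]; [rewrite cE|exact: sort_keys_nil].
    move=> u t y eN yt.
    have [cu au s1t] := eval_capsule eN (capsule_sub cN ss1 cK'.2).
    apply: H => //; apply/foldr_andP => p; rewrite sort_keysE => /mapP[p' p'c ->].
    exact: (realN p' p'c).2 eN.
  split.
    have [_ /is_absP[K' v0E] _] := eval_capsule ev0 cK; subst v0.
    have [[u [s1 eN]] H] := body _ _ ev0.
    have [y ys1] := exists_notin (domf s1).
    have [[v [t eK]] _] := H u s1 y eN ys1.
    by exists v, t; exact: eval_App ev0 eN ys1 eK.
  move=> v t /eval_AppE[K' [s1 [u [s2 [y [eK eN ys2 eK']]]]]].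
  by have [_ /(_ u s2 y eN ys2)[_]] := body _ _ eK; apply.
- move=> /capsule_App[cK cN] er; case hda: (hd a) => H.
    have [||[v [t ev]] real] := IHN r s e (tl a) q _ _ H => //.
      by move=> z zN; apply: er; apply/List.in_app_iff; right.
    split; first by exists v, t; apply: eval_Oplus; rewrite hda.
    by move=> v' t' /eval_OplusE; rewrite hda; exact: real.
  have [||[v [t ev]] real] := IHK r s e (tl a) q _ _ H => //.
    by move=> z zN; apply: er; apply/List.in_app_iff; left.
  split; first by exists v, t; apply: eval_Oplus; rewrite hda.
  by move=> v' t' /eval_OplusE; rewrite hda; exact: real.
Qed.

Lemma realizes_star (s : cenv) : closed_env s ->
  forall x (q : Q), star s x q -> exists2 v, s.[? x]%fmap = Some v & realizes q v s.
Proof.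
move=> cs x.
pose l y : Val := [set q : Q | exists2 v, s.[? y]%fmap = Some v & realizes q v s].
apply: (@star_le_prefixed s l (fun=> false)) => // {}x v sx q qv.
exists v => //; have [av vs] := cs _ _ sx.
have [K vE] := is_absP av.
(* The realized tokens serve as the environment. The abstraction [v] evaluates to itself, so the
   claim about all evaluations yields [realizes q v s]. *)
have [|_] := @realizes_denote _ v id s l _ q _ (fun z _ p => id) qv.
  by rewrite rename_id; split.
by apply; rewrite rename_id vE; exact: (@eval_Abs _ _ (fun=> false)).
Qed.

Lemma eval_adequate M s a q : capsule M s -> denote M (star s) a q ->
  exists v t, eval M s a v t.
Proof.
move=> cM qM.
have := @realizes_denote _ M id s (star s) a q; rewrite rename_id.
by case=> // x _ p; exact: realizes_star cM.2 _ _.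
Qed.

(** * Passage to capsules modulo identification *)

Lemma capsule_equiv_refl M s : capsule_equiv M s M s.
Proof.
exists id; split=> [//||x _]; first by rewrite rename_id.
by case: s.[? x]%fmap => //= v; rewrite rename_id.
Qed.

Theorem mainTheorem1 (M : exp) (sigma : cenv) (alpha : coins) :
  capsule M sigma ->
  (forall (x : var) (N : exp) (tau : cenv),
     bigstep M sigma alpha (lambda x N) tau ->
     forall gamma : coins,
       denote M (star sigma) alpha = denote (lambda x N) (star tau) gamma /\
       denote (lambda x N) (star tau) gamma =
         vlam (strict (fun beta v => denote N (upd (star tau) v x) beta))) /\
  ((exists f : coins -> Val -> Val,
      vcontinuous f /\ denote M (star sigma) alpha = vlam f) ->
   exists (v : exp) (tau : cenv),
     reduced v tau /\ bigstep M sigma alpha v tau).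
Proof.
move=> cM; split.
  move=> x N tau [_ [cv _] [M' [s' [v' [t' [cM' MM' ev vv']]]]]] gamma.
  split; last exact: denote_lambda.
  have [cv' _ _] := eval_capsule ev cM'.
  (* The equality passes through the representatives on which the rules act. *)
  rewrite (denote_capsule_equiv _ cM cM' MM') (eval_sound ev cM' gamma).
  exact: denote_capsule_equiv.
move=> [f [_ Mf]].
have [|v [t ev]] := @eval_adequate M sigma alpha Qempty cM.
  by rewrite Mf; left.
have [cv av _] := eval_capsule ev cM.
exists v, t; split=> //; split=> //.
by exists M, sigma, v, t; split=> //; exact: capsule_equiv_refl.
Qed.
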